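(* Let $K$ be a compact Hausdorff space such that, for each $n\in\mathbb{N}$ and each closed set $F\subset K^n$, there is a decreasing sequence $(F_p)_{p\in\mathbb{N}}$ of closed separable subsets of $K^n$ such that $F=\bigcap_{p\in\mathbb{N}}F_p$. Then $\mathrm{Ba}(C_p(K))=\mathrm{Bo}(C_p(K))$.
   Context: $C(K)$ is the set of continuous real-valued functions on $K$, and $C_p(K)$ is $C(K)$ equipped with the pointwise convergence topology. For a topological space $T$, $\mathrm{Bo}(T)$ is the Borel $\sigma$-algebra generated by the open sets and $\mathrm{Ba}(T)$ is the Baire $\sigma$-algebra generated by all continuous real-valued functions on $T$. It is well known that $\mathrm{Ba}(C_p(K))$ is the $\sigma$-algebra generated by the evaluations $\delta_t$, $t\in K$. All topological spaces are assumed Hausdorff; separable means having a countable dense subset. *)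

(* Defs.v *)
From HB Require Import structures.
From mathcomp Require Import all_boot all_order all_algebra.
From mathcomp Require Import all_classical all_reals all_analysis.
Set Implicit Arguments.
Unset Strict Implicit.
Unset Printing Implicit Defensive.

Import numFieldNormedType.Exports.
Local Open Scope classical_set_scope.

(* The trace of the product topology of R^K on the continuous functions; the
   instances that the library puts on [continuousType] are tied to a choice of
   topology on [K -> R], so the initial topology is spelled out here. *)
Definition Cp (K : topologicalType) (R : realType) : topologicalType :=
  initial_topology (id : continuousType K R -> {ptws K -> R}).

Definition borel_sigma_algebra (T : topologicalType) : set (set T) :=
  <<s open >>.
Arguments borel_sigma_algebra : clear implicits.

Definition baire_sigma_algebra (R : realType) (T : topologicalType) :
    set (set T) :=
  <<s [set A | exists2 f : T -> R, continuous f &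
        exists2 B : set R, borel_sigma_algebra R B & A = f @^-1` B] >>.
Arguments baire_sigma_algebra : clear implicits.

(* For [A : set T], [separable A] refers to the type [set_type A] with the
   relative topology. *)
Definition separable (T : topologicalType) : Prop :=
  exists2 D : set T, countable D & dense D.

(* Main.v *)
Require Import Defs.
From HB Require Import structures.
From mathcomp Require Import all_boot all_order all_algebra.
From mathcomp Require Import all_classical all_reals all_analysis.
From mathcomp Require Import lra.
Set Implicit Arguments.
Unset Strict Implicit.
Unset Printing Implicit Defensive.

Import numFieldNormedType.Exports.
Local Open Scope classical_set_scope.

(* Let [U] be open in [C_p(K)].  For rational [q] and [k], the set [S] of tuples
   [t] in [K^n] such that [|f(t_i) - q_i| < 1/(k+1)] for all [i] forces [f] into
   [U] is closed, because the condition on [t] is open for each fixed continuous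
   [f].  [U] is the countable union, over [n], [q] and [k], of the sets of [f] with
   [|f(t_i) - q_i| <= 1/(2(k+1))] for some [t] in [S].  Writing [S] as a decreasing
   intersection of closed sets with countable dense subsets [D_p], compactness
   of [K^n] shows that such an [f] is one for which each [D_p] contains a [t] with
   [|f(t_i) - q_i| < 1/(2(k+1)) + 1/(p+1)], which is a Baire condition on [f]. *)

Import Order.TTheory GRing.Theory Num.Theory.
Local Open Scope ring_scope.

Lemma sigma_algebra_setC (T : Type) (G : set (set T)) (A : set T) :
  sigma_algebra [set: T] G -> G A -> G (~` A).
Proof. by case=> _ + _ GA; rewrite -setTD; exact. Qed.

Lemma sigma_algebra_countable_bigcup (T I : Type) (G : set (set T)) (D : set I)
    (F : I -> set T) :
  sigma_algebra [set: T] G -> countable D -> (forall i, D i -> G (F i)) ->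
  G (\bigcup_(i in D) F i).
Proof.
(* The empty index set is split off, because the union axiom needs an enumeration of [D] by all of
   [nat]. *)
case=> G0 _ GU /pfcard_geP[->|[e]] GF; first by rewrite bigcup_set0.
have -> : \bigcup_(i in D) F i = \bigcup_n F (e n).
  by rewrite -(bigcup_image setT e F) image_eq.
by apply: GU => n; apply: GF; apply: funS.
Qed.

Lemma sigma_algebra_countable_bigcap (T I : Type) (G : set (set T)) (D : set I)
    (F : I -> set T) :
  sigma_algebra [set: T] G -> countable D -> (forall i, D i -> G (F i)) ->
  G (\bigcap_(i in D) F i).
Proof.
move=> sG cD GF; rewrite -[X in G X]setCK setC_bigcap.
apply: sigma_algebra_setC => //; apply: sigma_algebra_countable_bigcup => // i Di.
by apply: sigma_algebra_setC => //; exact: GF.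
Qed.

Lemma baire_sub_borel (R : realType) (T : topologicalType) :
  baire_sigma_algebra R T `<=` borel_sigma_algebra T.
Proof.
apply: smallest_sub; first exact: smallest_sigma_algebra.
move=> _ [f f_cont [B + ->]].
pose P := [set B : set R | borel_sigma_algebra T (f @^-1` B)].
have [b0 bD bU] : sigma_algebra setT (borel_sigma_algebra T).
  exact: smallest_sigma_algebra.
apply: (smallest_sub (X := P)); first split.
- by rewrite /P /= preimage_set0.
- by move=> A PA; exact: bD.
- by move=> A PA; rewrite /P /= preimage_bigcup; exact: bU.
by move=> A /((continuousP f).1 f_cont) ofA; exact: sub_sigma_algebra.
Qed.

Lemma closed_cluster (T : topologicalType) (F : set_system T) (A : set T) (x : T) :
  closed A -> F A -> cluster F x -> A x.
Proof. by move=> cA FA Fx; apply: cA => B /(Fx _ _ FA). Qed.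

Lemma ptws_eval_continuous (I : choiceType) (T : topologicalType) (i : I) :
  continuous (fun t : {ptws I -> T} => t i).
Proof. exact: (@proj_continuous I (fun=> T) i). Qed.

Lemma Cp_eval_continuous (R : realType) (K : topologicalType) (x : K) :
  continuous (fun f : Cp K R => (f : K -> R) x).
Proof.
move=> f; apply: (@continuous_comp (Cp K R) {ptws K -> R} R id (fun g => g x)).
  exact: initial_continuous.
exact: ptws_eval_continuous.
Qed.

(** The sets [C] given by finitely many points and a positive radius generate a filter that
    converges pointwise to [f]. It therefore contains every neighbourhood of [f], in particular the
    open set [V] of which [U] is the trace. *)
Lemma Cp_nbhs (R : realType) (K : topologicalType) (U : set (Cp K R)) (f : Cp K R) :
  open U -> U f -> exists (n : nat) (t : 'I_n -> K) (e : R), 0 < e /\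
    forall g : Cp K R,
      (forall i, `|(g : K -> R) (t i) - (f : K -> R) (t i)| < e) -> U g.
Proof.
case=> V oV <- /= Vf.
pose C (p : seq K * R) := [set g : {ptws K -> R} |
  forall x, x \in p.1 -> `|g x - (f : K -> R) x| < p.2].
pose F : set_system {ptws K -> R} := filter_from [set p | 0 < p.2] C.
have FF : Filter F.
  apply: filter_from_filter; first by exists ([::], 1) => /=.
  move=> [s d] [s' d'] /= d0 d'0; exists (s ++ s', Num.min d d').
    (* Concatenating the lists and taking the smaller radius refines both sets. *)
    by rewrite /= lt_min d0 d'0.
  move=> g /= gC; split=> x /= xs.
    by have := gC x; rewrite mem_cat xs lt_min => /(_ isT)/andP[].
  by have := gC x; rewrite mem_cat xs orbT lt_min => /(_ isT)/andP[].
have : {ptws, F --> (f : K -> R)}.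
  apply/pointwise_cvgP => x A /nbhs_ballP[e /= e0 eA].
  exists ([:: x], e) => //= g /(_ x); rewrite inE eqxx => /(_ isT) gx.
  by apply: eA; rewrite /ball /= distrC.
move=> /(_ V) []; first exact: open_nbhs_nbhs.
move=> [s e] /= e0 sV; exists (size s), (tnth (in_tuple s)), e; split=> // g gs.
apply: sV => x /= /(tnthP (in_tuple s))[i ->]; exact: gs.
Qed.

(** Pushing the dense set forward along [set_val] trades the relative topology for open sets of [T],
    so the subtype is not met again. *)
Lemma separable_countable_subset (T : topologicalType) (A : set T) :
  separable A -> exists D : set T, [/\ countable D, D `<=` A &
    forall W, open W -> A `&` W !=set0 -> D `&` W !=set0].
Proof.
case=> D cD dD; exists (set_val @` D); split.
- exact: card_le_trans (card_image_le _ _) cD.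
- by move=> _ [x _ <-]; exact: set_valP.
move=> W oW [x [Ax Wx]].
have [] := dD (set_val @^-1` W).
- by exists (SigSub (mem_set Ax)).
- by exists W.
by move=> y [Wy Dy]; exists (set_val y); split=> //; exists y.
Qed.

Lemma near_Cp_tuple (R : realType) (K : topologicalType) (f : Cp K R) (n : nat)
    (t : {ptws 'I_n -> K}) (q : 'I_n -> R) (r : R) :
  (forall i, `|(f : K -> R) (t i) - q i| < r) ->
  \forall u \near t, forall i, `|(f : K -> R) (u i) - q i| < r.
Proof.
move=> ft; apply: (@filter_forall _ _ (fun i (u : {ptws 'I_n -> K}) =>
  `|(f : K -> R) (u i) - q i| < r) (nbhs t)) => i.
have f_cont : (fun u : {ptws 'I_n -> K} => (f : K -> R) (u i)) @ t -->
    (f : K -> R) (t i).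
  apply: (@continuous_comp {ptws 'I_n -> K} K R (fun u => u i) (f : K -> R)).
    exact: ptws_eval_continuous.
  exact: cts_fun.
(* The strict inequality at [t] leaves this margin for the variation of [f] in coordinate [i];
   finiteness of ['I_n] handles all coordinates at once. *)
have gap : 0 < r - `|(f : K -> R) (t i) - q i| by rewrite subr_gt0.
move/cvgrPdist_lt : f_cont => /(_ _ gap); apply: filterS => u.
rewrite ltrBrDr; apply: le_lt_trans.
by rewrite [X in _ <= X + _]distrC; exact: ler_distD.
Qed.

Lemma closed_forced_tuples (R : realType) (K : topologicalType) (U : set (Cp K R))
    (n : nat) (q : 'I_n -> R) (r : R) :
  closed [set t : {ptws 'I_n -> K} | forall f : Cp K R,
    (forall i, `|(f : K -> R) (t i) - q i| < r) -> U f].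
Proof. by move=> t clt f /near_Cp_tuple /clt[u [+ fu]]; apply. Qed.

Lemma closed_Cp_tuple (R : realType) (K : topologicalType) (f : Cp K R) (n : nat)
    (q : 'I_n -> R) (r : R) :
  closed [set t : {ptws 'I_n -> K} | forall i, `|(f : K -> R) (t i) - q i| <= r].
Proof.
move=> t clt i; apply/ler_addgt0Pr => e e0.
have : \forall u \near t, forall i, `|(f : K -> R) (u i) - (f : K -> R) (t i)| < e.
  by apply: near_Cp_tuple => j; rewrite subrr normr0.
move/clt => [u [/(_ i) ui /(_ i) uti]].
rewrite (le_trans (ler_distD ((f : K -> R) (u i)) _ _))// addrC lerD// distrC.
exact: ltW.
Qed.

Lemma baire_Cp_tuple (R : realType) (K : topologicalType) (n : nat) (t : 'I_n -> K)
    (q : 'I_n -> R) (r : R) :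
  baire_sigma_algebra R (Cp K R)
    [set f : Cp K R | forall i, `|(f : K -> R) (t i) - q i| < r].
Proof.
have -> : [set f : Cp K R | forall i, `|(f : K -> R) (t i) - q i| < r] =
    \bigcap_i ((fun f : Cp K R => (f : K -> R) (t i)) @^-1` ball (q i) r).
  apply/seteqP; split=> f /= fr i; last by have := fr i I; rewrite /ball /= distrC.
  by move=> _; rewrite /ball /= distrC.
apply: sigma_algebra_countable_bigcap; first exact: smallest_sigma_algebra.
  exact: countableP.
move=> i _; apply: sub_sigma_algebra.
exists (fun f : Cp K R => (f : K -> R) (t i)); first exact: Cp_eval_continuous.
by exists (ball (q i) r) => //; apply: sub_sigma_algebra; exact: ball_open.
Qed.

Lemma baire_Cp_exists_tuple (R : realType) (K : topologicalType) (n : nat)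
    (F : set {ptws 'I_n -> K}) (Fs : nat -> set {ptws 'I_n -> K})
    (q : 'I_n -> R) (r : R) :
  compact [set: K] ->
  (forall p, closed (Fs p)) -> (forall p, separable (Fs p)) ->
  (forall p, Fs p.+1 `<=` Fs p) -> F = \bigcap_p Fs p ->
  baire_sigma_algebra R (Cp K R)
    [set f : Cp K R | exists2 t : {ptws 'I_n -> K},
      F t & forall i, `|(f : K -> R) (t i) - q i| <= r].
Proof.
move=> cK clFs sFs decFs ->.
have /choice[D DP] := fun p => separable_countable_subset (sFs p).
set A := [set f | _].
have -> : A = \bigcap_p \bigcup_(t in D p)
    [set f : Cp K R | forall i, `|(f : K -> R) (t i) - q i| < r + p.+1%:R^-1].
  apply/seteqP; split=> f /=.
    move=> [t Ft fr] p _.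
    have [_ _ dD] := DP p.
    (* The added [p.+1%:R^-1] makes the bound strict at [t], hence valid on a neighbourhood of [t],
       which meets [D p] because [t] lies in [Fs p]. *)
    have : nbhs t [set u | forall i, `|(f : K -> R) (u i) - q i| < r + p.+1%:R^-1].
      by apply: near_Cp_tuple => i; rewrite (le_lt_trans (fr i))// ltrDl invr_gt0.
    rewrite nbhsE => -[W [oW Wt] Wf].
    have [|u [Du Wu]] := dD W oW; first by exists t; split=> //; exact: Ft.
    by exists u => //; exact: Wf.
  move=> fD.
  have /choice[t tP] : forall p, exists t : {ptws 'I_n -> K}, D p t /\
      forall i, `|(f : K -> R) (t i) - q i| < r + p.+1%:R^-1.
    by move=> p; have [t Dt ft] := fD p I; exists t.
  have Fs_le m p : (m <= p)%N -> Fs p `<=` Fs m.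
    move=> /subnK <-; elim: (p - m)%N => [//|k IH]; rewrite addSn.
    exact: subset_trans (decFs _) IH.
  (* The approximate solutions [t p] have a cluster point in the compact power of [K]; it will be an
     exact solution. *)
  have [u [_ clu]] : [set: {ptws 'I_n -> K}] `&` cluster (t @ \oo) !=set0.
    have := @tychonoff 'I_n (fun=> K) (fun=> setT) (fun=> cK).
    have -> : [set f : forall i : 'I_n, K | forall i, [set: K] (f i)] = setT.
      by apply/seteqP; split.
    by move=> /(_ (t @ \oo) _ filterT).
  exists u.
    (* From rank [m] on, the sequence stays in the closed set [Fs m], since the sets decrease. *)
    move=> m _; apply: (closed_cluster (clFs m) _ clu).
    exists m => //= p mp; apply: (Fs_le _ _ mp).
    by have [_ DF _] := DP p; apply: DF; have [] := tP p.
  move=> i; apply/ler_addgt0Pr => e e0.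
  (* Once [p.+1%:R^-1 < e], the tuple [t p] lies in the closed set with bound [r + e], so [u] does
     too; [e] is arbitrary. *)
  have near_u : (t @ \oo) [set v | forall j, `|(f : K -> R) (v j) - q j| <= r + e].
    have := near_infty_natSinv_lt (PosNum e0); apply: filterS => p /= pe j.
    by have [_ /(_ j) /ltW/le_trans] := tP p; apply; rewrite lerD2l ltW.
  exact: (closed_cluster (@closed_Cp_tuple R K f n q (r + e)) near_u clu i).
apply: sigma_algebra_countable_bigcap; first exact: smallest_sigma_algebra.
  exact: countableP.
move=> p _; have [cD _ _] := DP p.
apply: sigma_algebra_countable_bigcup => //; first exact: smallest_sigma_algebra.
by move=> t _; exact: baire_Cp_tuple.
Qed.

Theorem corollary3p4 (R : realType) (K : topologicalType)
  (K_compact : compact [set: K])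
  (K_hausdorff : hausdorff_space K)
  (K_powers : forall (n : nat) (F : set {ptws 'I_n -> K}), closed F ->
    exists Fs : nat -> set {ptws 'I_n -> K},
      [/\ forall p : nat, closed (Fs p),
          forall p : nat, separable (Fs p),
          forall p : nat, Fs p.+1 `<=` Fs p
        & F = \bigcap_(p in [set: nat]) Fs p]) :
  baire_sigma_algebra R (Cp K R) = borel_sigma_algebra (Cp K R).
Proof.
apply/seteqP; split; first exact: baire_sub_borel.
have sB : sigma_algebra setT (baire_sigma_algebra R (Cp K R)).
  exact: smallest_sigma_algebra.
apply: smallest_sub => // U oU.
pose r (k : nat) : R := k.+1%:R^-1.
pose S n (q : 'I_n -> R) k := [set t : {ptws 'I_n -> K} | forall f : Cp K R,
    (forall i, `|(f : K -> R) (t i) - q i| < r k) -> U f].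
pose E n (q : 'I_n -> R) k := [set f : Cp K R | exists2 t : {ptws 'I_n -> K},
    S n q k t & forall i, `|(f : K -> R) (t i) - q i| <= r k / 2].
(* Finitely supported functions into [rat] are stored as [ffun] so that the index type is
   countable. *)
pose J := {n : nat & {ffun 'I_n -> rat}}.
have -> : U = \bigcup_(j in [set: J * nat])
    E (tag j.1) (fun i => ratr (tagged j.1 i)) j.2.
  apply/seteqP; split=> f.
    move=> Uf; have [n [t [e [e0 te]]]] := Cp_nbhs oU Uf.
    (* With [r k < e / 2], a function within [r k] of [q] at the points of [t] is within
       [r k + r k / 2 < e] of [f] there. *)
    have e20 : 0 < e / 2 by rewrite divr_gt0.
    have [k _ /(_ k (leqnn k)) /= ke] := near_infty_natSinv_lt (PosNum e20).
    have rk : r k < e / 2 by exact: ke.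
    have r0 : 0 < r k by rewrite invr_gt0.
    have /choice[q qP] : forall i, exists q : rat,
        `|ratr q - (f : K -> R) (t i)| <= r k / 2.
      move=> i; set y := (f : K -> R) (t i).
      have [|q] := @rat_in_itvoo R (y - r k / 2) y.
        by rewrite ltrBlDr ltrDl divr_gt0.
      rewrite in_itv /= => /andP[yq qy]; exists q.
      by rewrite distrC ger0_norm ?subr_ge0 ?(ltW qy)// lerBlDl -lerBlDr ltW.
    exists (Tagged (fun n => {ffun 'I_n -> rat}) [ffun i => q i], k) => //.
    exists t => [g gq|i /=]; last by rewrite ffunE distrC.
    apply: te => i; have := gq i; rewrite /= ffunE => giq.
    rewrite (le_lt_trans (ler_distD (ratr (q i)) _ _))//.
    rewrite (lt_le_trans (ltr_leD giq (qP i)))//.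
    by move: (r k) rk r0 => z; lra.
  (* Since [r k / 2 < r k], the function [f] itself meets the condition that forces membership in
     [U]. *)
  move=> [[[n q] k] _ [t St ft]]; apply: St => i.
  by rewrite (le_lt_trans (ft i))// ltr_pdivrMr// ltr_pMr ?ltr1n// invr_gt0.
apply: sigma_algebra_countable_bigcup => //; first exact: countableP.
move=> [[n q] k] _.
have [Fs [clFs sFs decFs SFs]] :=
  K_powers n _ (@closed_forced_tuples R K U n (fun i => ratr (q i)) (r k)).
exact: (baire_Cp_exists_tuple _ _ K_compact clFs sFs decFs SFs).
Qed.
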